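(* Let $n,d$ be positive integers. Every matrix $M\in\mathcal{M}(n,d)$ can be factored into a product, with respect to the operation $\circ$, of finitely many diagonal and almost diagonal matrices in $\mathcal{M}(n,d)$.
   Context: $\mathcal{M}(n,d)$ is the set of $n\times n$ matrices with non-negative integer entries with total sum of entries $d$. Let $V=\mathbb{C}^d$, $G=GL(V)$, and let $\mathcal{F}_n^d$ be the variety of partial flags $\{0\}=U_0\subset U_1\subset\dots\subset U_n=V$ (all possible dimensions, inclusions not necessarily strict). The $G$-orbits of the diagonal action on $\mathcal{F}_n^d\times\mathcal{F}_n^d$ are in bijection with $\mathcal{M}(n,d)$: $\mathbb{O}_M$ consists of pairs $(\mathbf{U},\mathbf{W})$ with $\dim U_a\cap W_b=\sum_{i\le a,\,j\le b}m_{ij}$ for all $a,b$. Let $\mathbf{R}^M$ and $\mathbf{C}^M$ be the vectors of row sums and column sums of $M$. Let $\pi_{ij}:\mathcal{F}_n^d\times\mathcal{F}_n^d\times\mathcal{F}_n^d\to\mathcal{F}_n^d\times\mathcal{F}_n^d$ be the projections. If $\mathbf{C}^M=\mathbf{R}^N$, then $\pi_{13}(\pi_{12}^{-1}(\mathbb{O}_M)\cap\pi_{23}^{-1}(\mathbb{O}_N))$ is irreducible and $M\circ N$ is the matrix such that $\mathbb{O}_{M\circ N}$ is the unique orbit contained in and open in this set. If $\mathbf{C}^M\ne\mathbf{R}^N$, then $M\circ N:=0$. The operation $\circ$ is associative. A matrix in $\mathcal{M}(n,d)$ is almost diagonal if it is of the form $\mathbf{E}(\mu,k)=\mathrm{Diag}(\mu)+E_{k,k+1}$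 or $\mathbf{F}(\mu,k)=\mathrm{Diag}(\mu)+E_{k+1,k}$, where $1\le k<n$, $\mu\in\mathbb{Z}_{\ge0}^n$ with $\sum\mu_i=d-1$, $\mathrm{Diag}(\mu)$ is the diagonal matrix with diagonal $\mu$, and $E_{ij}$ is the matrix unit. *)

(* Defs.v *)
From mathcomp Require Import all_boot all_order all_algebra.
From mathcomp Require Import boolp classical_sets.
From mathcomp Require mpoly.

Set Implicit Arguments.
Unset Strict Implicit.
Unset Printing Implicit Defensive.

Import GRing.Theory.
Local Open Scope ring_scope.
Local Open Scope classical_set_scope.

Definition natmx (n d : nat) :=
  {M : 'M[nat]_n | (\sum_i \sum_j M i j == d)%N}.

Definition row_sums n d (M : natmx n d) : 'rV[nat]_n :=
  \row_i (\sum_j val M i j)%N.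

Definition col_sums n d (M : natmx n d) : 'rV[nat]_n :=
  \row_j (\sum_i val M i j)%N.

Definition diagonal n d (M : natmx n d) : Prop := is_diag_mx (val M).

Definition almost_diagonal n d (M : natmx n d) : Prop :=
  exists (mu : 'rV[nat]_n) (k k1 : 'I_n),
    [/\ k1 = k.+1 :> nat, (\sum_i mu ord0 i = d.-1)%N &
        val M = diag_mx mu + delta_mx k k1 \/
        val M = diag_mx mu + delta_mx k1 k].

Section Flags.
Variables (K : fieldType) (n d : nat).

Definition GL := {g : 'M[K]_d | g \in unitmx}.

Record flag := Flag {
  flag_at :> 'I_n.+1 -> {vspace 'cV[K]_d};
  flag_bot : flag_at ord0 = 0%VS;
  flag_top : flag_at ord_max = fullv;
  flag_sub : forall a b : 'I_n.+1,
    (a <= b)%N -> (flag_at a <= flag_at b)%VS }.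

Definition act_at (g : GL) (U : flag) (a : 'I_n.+1) : {vspace 'cV[K]_d} :=
  (linfun (mulmx (val g)) @: U a)%VS.

Lemma act_bot g U : act_at g U ord0 = 0%VS.
Proof. by rewrite /act_at flag_bot limg0. Qed.

Lemma act_top g U : act_at g U ord_max = fullv.
Proof.
rewrite /act_at flag_top; apply/eqP; rewrite eqEsubv subvf /=.
apply/subvP => v _; apply/memv_imgP.
exists (invmx (val g) *m v); first exact: memvf.
by rewrite lfunE /= mulKVmx // (valP g).
Qed.

Lemma act_sub g U (a b : 'I_n.+1) :
  (a <= b)%N -> (act_at g U a <= act_at g U b)%VS.
Proof. by move=> ab; apply/limgS/flag_sub. Qed.

Definition act (g : GL) (U : flag) : flag :=
  Flag (act_bot g U) (act_top g U) (@act_sub g U).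

Definition zariski_open_affine N (A : set 'rV[K]_N) : Prop :=
  exists P : set (mpoly.mpoly N K),
    A = [set v | exists2 p, P p & mpoly.meval (v 0) p != 0].

(* GL x GL carries the topology induced from the affine space of pairs of
   d x d matrices. *)
Definition zariski_open_GL2 (A : set (GL * GL)) : Prop :=
  exists2 B : set 'rV[K]_(d * d + d * d), zariski_open_affine B &
    A = [set gh : GL * GL | B (row_mx (mxvec (val gh.1)) (mxvec (val gh.2)))].

(* The variety of flags is the disjoint union of the homogeneous spaces G/P,
   one for each dimension vector, P being the stabilizer of a flag U and the
   identification being g P |-> g U.  The Zariski topology of the product
   G/P x G/Q = (G x G)/(P x Q) is the quotient topology of that of G x G (it is
   finer than the product of the topologies of the factors), and the components
   are open: hence a set of pairs of flags is open iff its preimages by all the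
   orbit maps (g, h) |-> (g U, h W) are open. *)
Definition zariski_open (Z : set (flag * flag)) : Prop :=
  forall U W : flag, zariski_open_GL2 [set gh : GL * GL | Z (act gh.1 U, act gh.2 W)].

Definition open_in (S A : set (flag * flag)) : Prop :=
  exists2 Z, zariski_open Z & A = Z `&` S.

(* Rows and columns are numbered from 0, whence the strict bounds. *)
Definition orbit (M : natmx n d) : set (flag * flag) :=
  [set UW : flag * flag | forall a b : 'I_n.+1,
    \dim (UW.1 a :&: UW.2 b)%VS =
      (\sum_(i < n | i < a) \sum_(j < n | j < b) val M i j)%N].

Definition conv (M N : natmx n d) : set (flag * flag) :=
  [set UW : flag * flag | exists X : flag, orbit M (UW.1, X) /\ orbit N (X, UW.2)].

Definition open_orbit (M N L : natmx n d) : Prop :=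
  orbit L `<=` conv M N /\ open_in (conv M N) (orbit L).

(* None is the adjoined zero.  It is also the (junk) value if the open orbit
   fails to exist or to be unique. *)
Definition circ (M N : natmx n d) : option (natmx n d) :=
  if col_sums M == row_sums N
  then xget None [set Some L | L in unique (open_orbit M N)]
  else None.

(* A0 o (A1 o (A2 o ...)) for s = A1, A2, ..., zero being absorbing.  There is
   no empty product, as natmx n d has no unit for circ in general. *)
Fixpoint circ_prod (A0 : natmx n d) (s : seq (natmx n d)) :
    option (natmx n d) :=
  if s is A1 :: s' then obind (circ A0) (circ_prod A1 s') else Some A0.

End Flags.

(* Main.v *)
Require Import Defs.
From mathcomp Require Import all_boot all_order all_algebra.
From mathcomp Require Import boolp classical_sets.
From mathcomp Require Import(canonicals) mpoly.
From mathcomp Require Import reals complex.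
From mathcomp Require Import zify.
Import Defs.

(** The operation is computed in one family of cases, sufficient for a factorization.
    A matrix is presented as the contingency table [natmx_of la nu] of two labelings of
    [d] elements by rows and columns; by [adapted_basis] the pairs of flags in its orbit
    are exactly the translates of the two coordinate flags of [la] and [nu]. So if [la'] is a
    third labeling, the orbit of [(la, nu)] is contained in the convolution of those of
    [(la, la')] and [(la', nu)].

    It is open there when [(la, nu)] has the smallest intersections [U a :&: W b] of all
    pairs in the convolution, since bounding these dimensions from above is a Zariski open
    condition ([cap_le_open]). Uniqueness of the open orbit is a form of
    irreducibility: two points of the convolution are joined by a line of matrices
    stabilizing the middle flag, and over an infinite field two nonempty open subsets of
    that line meet ([open_orbit_unique]). This gives the product ([circ_natmx_of]).

    Let now [la'] differ from [la] at a single element [t0], moved to an adjacent row [k].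
    Then [natmx_of la la'] is almost diagonal, and minimality holds if no element of row
    [k] lies in a column beyond that of [t0] when [t0] moves to the next row, and no
    element of row [k] in a column before that of [t0] when [t0] moves to the previous
    row ([conv_rank_ge_up], [conv_rank_ge_down]). In a matrix that is not diagonal an
    extremal choice of [t0] always makes such a move possible towards the diagonal. The
    sum of the distances between row and column then decreases, and induction on it ends
    at a diagonal matrix ([factorization]). *)

Set Implicit Arguments.
Unset Strict Implicit.
Unset Printing Implicit Defensive.

Import GRing.Theory.
Local Open Scope ring_scope.

(** * Matrices as contingency tables of pairs of labelings *)

Section Labelings.
Variables n d : nat.
Implicit Types (la nu : 'I_d -> 'I_n) (M : natmx n d).

Lemma card_sum (P : pred 'I_d) : #|[pred t | P t]| = (\sum_t P t)%N.
Proof.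
by rewrite -sum1_card big_mkcond; apply: eq_bigr => t _; rewrite inE; case: (P t).
Qed.

Lemma card_and (P Q : pred 'I_d) :
  #|[pred t | P t && Q t]| = (\sum_(t | P t) Q t)%N.
Proof. by rewrite -sum1_card -big_mkcondr; apply: eq_bigl => t. Qed.

Lemma sum_fibers (F : 'I_d -> nat) la (P : pred 'I_n) :
  (\sum_(i | P i) \sum_(t | la t == i) F t = \sum_(t | P (la t)) F t)%N.
Proof.
rewrite (partition_big la P) //=; apply: eq_bigr => i Pi.
by apply: eq_bigl => t; case: eqP => [->|_]; rewrite ?Pi ?andbF.
Qed.

(** Row [i] lies between the flag indices [lo i] and [hi i]: a box of the matrix is
    cut out by consecutive steps of the two flags. *)
Definition lo (i : 'I_n) : 'I_n.+1 := widen_ord (leqnSn n) i.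
Definition hi (i : 'I_n) : 'I_n.+1 := lift ord0 i.

(** Every matrix is used through a pair of labelings [la], [nu] of [d] elements by rows
    and columns: the elements will index a basis of the ambient space, and moving a
    unit of the matrix to another row amounts to changing one value of [la]. *)
Definition label_mx la nu : 'M[nat]_n :=
  \matrix_(i, j) #|[pred t | (la t == i) && (nu t == j)]|.

Lemma sum_label_mx la nu (P Q : pred 'I_n) :
  (\sum_(i | P i) \sum_(j | Q j) label_mx la nu i j)%N =
  #|[pred t | P (la t) && Q (nu t)]|.
Proof.
rewrite card_and -(sum_fibers (fun t => Q (nu t) : nat)).
apply: eq_bigr => i _.
transitivity (\sum_(j | Q j) \sum_(t | nu t == j) (la t == i))%N.
  apply: eq_bigr => j _; rewrite mxE -card_and; apply: eq_card => t.
  by rewrite !inE andbC.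
rewrite (sum_fibers (fun t => (la t == i) : nat)) -!card_and.
by apply: eq_card => t; rewrite !inE andbC.
Qed.

Lemma label_mx_total la nu : (\sum_i \sum_j label_mx la nu i j == d)%N.
Proof. by rewrite sum_label_mx cardT size_enum_ord. Qed.

Definition natmx_of la nu : natmx n d := exist _ (label_mx la nu) (label_mx_total la nu).

(** List each box as many times as its entry says; the positions in that list, of
    length [d], are the labeled elements. *)
Lemma natmx_of_surj M : exists la nu, M = natmx_of la nu.
Proof.
pose s := flatten [seq nseq (val M p.1 p.2) p | p <- enum {: 'I_n * 'I_n}].
have sz : size s = d.
  apply: etrans (eqP (valP M)); rewrite pair_big size_flatten /shape -map_comp.
  by rewrite sumnE big_map big_enum /=; apply: eq_bigr => p _; rewrite size_nseq.
pose tt : d.-tuple _ := Tuple (introT eqP sz).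
exists (fun t => (tnth tt t).1), (fun t => (tnth tt t).2).
apply: val_inj; apply/matrixP => i j; rewrite mxE.
transitivity (count_mem (i, j) s).
  rewrite count_flatten -map_comp sumnE big_map big_enum /= (bigD1 (i, j)) //=.
  rewrite count_nseq /= eqxx mul1n big1 ?addn0 // => p pij.
  by rewrite count_nseq /= (negPf pij).
rewrite -sum1_count -[s]/(val tt) big_tuple sum1_card; apply: eq_card => t.
by rewrite !inE -xpair_eqE -surjective_pairing.
Qed.

(** Inclusion-exclusion around one box: rank data determine the matrix. *)
Lemma card_box la nu (i j : 'I_n) :
  (#|[pred t | (la t < i.+1) && (nu t < j.+1)]| +
   #|[pred t | (la t < i) && (nu t < j)]| =
   #|[pred t | (la t < i) && (nu t < j.+1)]| +
   #|[pred t | (la t < i.+1) && (nu t < j)]| +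
   #|[pred t | (la t == i) && (nu t == j)]|)%N.
Proof.
rewrite !card_sum -!big_split; apply: eq_bigr => t _ /=.
rewrite -!val_eqE /= !ltnS.
by case: (ltngtP (la t) i); case: (ltngtP (nu t) j).
Qed.

(** Linear inequalities between cardinals are checked element by element. *)
Lemma leq_card2 (P Q P' Q' : pred 'I_d) :
    (forall t, P t + Q t <= P' t + Q' t)%N ->
  (#|[pred t | P t]| + #|[pred t | Q t]| <= #|[pred t | P' t]| + #|[pred t | Q' t]|)%N.
Proof.
by move=> le; rewrite !card_sum -!big_split; apply: leq_sum => t _; apply: le.
Qed.

End Labelings.

(** * Standard flags and bases adapted to a pair of flags *)

Section Flags.
Variables (K : fieldType) (n d : nat).
Implicit Types (la nu : 'I_d -> 'I_n) (M : natmx n d).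
Implicit Types (U W X : flag K n d) (g h : GL K d).
Local Notation V := 'cV[K]_d.

Definition coordv (P : pred 'I_d) : {vspace V} :=
  (\sum_(t | P t) <[delta_mx t ord0]>)%VS.

Lemma memv_coordv P (v : V) :
  reflect (forall t, ~~ P t -> v t ord0 = 0) (v \in coordv P).
Proof.
apply: (iffP memv_sumP) => [[vs vsP ->] t nPt|v0].
  rewrite summxE big1 // => u Pu; have /vlineP[k ->] := vsP u Pu.
  by rewrite !mxE; case: eqP => [tu|_]; [rewrite tu Pu in nPt | rewrite mulr0].
exists (fun t => v t ord0 *: delta_mx t ord0) => [t _|].
  by rewrite memvZ ?memv_line.
rewrite [LHS]matrix_sum_delta [RHS]big_mkcond /=; apply: eq_bigr => t _.
by rewrite big_ord1; case: ifPn => // /v0 ->; rewrite scale0r.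
Qed.

Lemma coordv_cap P Q :
  (coordv P :&: coordv Q)%VS = coordv [pred t | P t && Q t].
Proof.
apply/vspaceP => v; rewrite memv_cap.
apply/andP/memv_coordv => [[/memv_coordv vP /memv_coordv vQ] t|vPQ].
  by rewrite /= negb_and => /orP[/vP|/vQ].
by split; apply/memv_coordv => t Pt; apply: vPQ; rewrite /= negb_and Pt ?orbT.
Qed.

Lemma coordvT : coordv predT = fullv.
Proof. by apply/vspaceP => v; rewrite memvf; apply/memv_coordv. Qed.

Lemma coordvS (P Q : pred 'I_d) :
  (forall t, P t -> Q t) -> (coordv P <= coordv Q)%VS.
Proof.
move=> PQ; apply/subvP => v /memv_coordv v0; apply/memv_coordv => t nQ.
by apply: v0; apply: contra nQ; apply: PQ.
Qed.

(** The dimension is at most the cardinal, and the same bound for the complementary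
    coordinate subspace forces equality. *)
Lemma dim_coordv P : \dim (coordv P) = #|P|.
Proof.
have le_card Q : (\dim (coordv Q) <= #|Q|)%N.
  rewrite -sum1_card; apply: leq_trans (dimv_leq_sum _ _ _) _.
  by apply: leq_sum => t _; rewrite dim_vline leq_b1.
have full : (coordv P + coordv [predC P])%VS = fullv.
  by rewrite -coordvT /coordv [RHS](bigID P).
apply/eqP; rewrite eqn_leq le_card -(leq_add2r #|[predC P]|) cardC /=.
apply: leq_trans (leq_add (leqnn _) (le_card [predC P])).
apply: leq_trans (dimv_add_leqif _ _).
by rewrite full dimvf /dim /= muln1 card_ord.
Qed.

Lemma lker_GL g : lker (linfun (mulmx (val g) : V -> V)) == 0%VS.
Proof.
apply/lker0P => x y; rewrite !lfunE /= => xy.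
by rewrite -[x](mulKmx (valP g)) xy mulKmx ?(valP g).
Qed.

Lemma dim_act_cap g U W (a b : 'I_n.+1) :
  \dim (act g U a :&: act g W b) = \dim (U a :&: W b).
Proof.
rewrite -(limg_dim_eq (f := linfun (mulmx (val g) : V -> V)) (U := (U a :&: W b)%VS)).
  congr (\dim _); apply/vspaceP => v; rewrite memv_cap.
  apply/andP/memv_imgP => [[/memv_imgP[x xU ->] /memv_imgP[y yW xy]]|[x]].
    exists x => //; rewrite memv_cap xU.
    by rewrite (lker0P (lker_GL g) _ _ xy).
  by rewrite memv_cap => /andP[xU xW] ->; rewrite !memv_img.
by rewrite (eqP (lker_GL g)) capv0.
Qed.

Lemma orbit_act M g U W : orbit M (act g U, act g W) <-> orbit M (U, W).
Proof. by split=> UW a b; rewrite -UW /= dim_act_cap. Qed.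

Lemma flag_eq U W : (forall a, U a = W a) -> U = W.
Proof.
case: U W => [U U0 U1 US] [W W0 W1 WS] /= UW.
have eUW : U = W by apply/funext.
case: _ / eUW in W0 W1 WS UW *.
by congr Flag; apply: Prop_irrelevance.
Qed.

Fact std_bot la : coordv (fun t => (la t < (ord0 : 'I_n.+1))%N) = 0%VS.
Proof. by rewrite /coordv big_pred0. Qed.

Fact std_top la : coordv (fun t => (la t < (ord_max : 'I_n.+1))%N) = fullv.
Proof. by rewrite -coordvT /coordv; apply: eq_bigl => t; rewrite ltn_ord. Qed.

Fact std_sub la (a b : 'I_n.+1) : (a <= b)%N ->
  (coordv (fun t => (la t < a)%N) <= coordv (fun t => (la t < b)%N))%VS.
Proof. by move=> ab; apply: coordvS => t /leq_trans; apply. Qed.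

(** The coordinate flag of a labeling. A pair of coordinate flags is the base point of
    its orbit. *)
Definition std la : flag K n d := Flag (std_bot la) (std_top la) (@std_sub la).

Lemma orbit_std la nu g : orbit (natmx_of la nu) (act g (std la), act g (std nu)).
Proof.
apply/orbit_act => a b /=; rewrite coordv_cap dim_coordv.
by rewrite (sum_label_mx la nu (fun i => i < a)%N (fun j => j < b)%N).
Qed.

Lemma orbit_dim la nu U W a b : orbit (natmx_of la nu) (U, W) ->
  \dim (U a :&: W b) = #|[pred t | (la t < a)%N && (nu t < b)%N]|.
Proof.
by move=> ->; rewrite -(sum_label_mx la nu (fun i => i < a)%N (fun j => j < b)%N).
Qed.

Lemma orbit_diml la nu U W a : orbit (natmx_of la nu) (U, W) ->
  \dim (U a) = #|[pred t | (la t < a)%N]|.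
Proof.
move=> /(orbit_dim a ord_max); rewrite flag_top capvf => ->.
by apply: eq_card => t; rewrite !inE ltn_ord andbT.
Qed.

Lemma orbit_dimr la nu U W b : orbit (natmx_of la nu) (U, W) ->
  \dim (W b) = #|[pred t | (nu t < b)%N]|.
Proof.
by move=> /(orbit_dim ord_max b); rewrite flag_top capfv => ->;
  apply: eq_card => t; rewrite !inE ltn_ord.
Qed.

(** A family of [d] spanning vectors is a basis, hence the family of columns of an
    invertible matrix. *)
Lemma GL_of_span (e : 'I_d -> V) : (\sum_t <[e t]>)%VS = fullv ->
  exists g : GL K d, forall t, val g *m delta_mx t ord0 = e t.
Proof.
move=> efull; pose g : 'M[K]_d := \matrix_(i, t) e t i ord0.
have ge t : g *m delta_mx t ord0 = e t.
  by rewrite -colE; apply/colP => i; rewrite !mxE.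
suff gU : g \in unitmx by exists (exist _ g gU).
have pre t : exists x : V, g *m x = delta_mx t ord0.
  have: (delta_mx t ord0 : V) \in (\sum_t <[e t]>)%VS by rewrite efull memvf.
  move=> /memv_sumP[vs vsP ->].
  have /fin_all_exists[k kP] u : exists k, vs u = k *: e u.
    by have /vlineP := vsP u isT.
  exists (\sum_u k u *: delta_mx u ord0); rewrite mulmx_sumr.
  by apply: eq_bigr => u _; rewrite -scalemxAr ge kP.
have /fin_all_exists[h hP] := pre.
have gh : g *m (\matrix_(i, t) h t i ord0) = 1%:M.
  apply/matrixP => i j; have /colP/(_ i) := hP j; rewrite !mxE eqxx andbT => <-.
  by apply: eq_bigr => k _; rewrite !mxE.
by case: (mulmx1_unit gh).
Qed.

Lemma act_std la g U (e : 'I_d -> V) :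
    (forall t, val g *m delta_mx t ord0 = e t) ->
    (forall a : 'I_n.+1, U a = \sum_(t | (la t < a)%N) <[e t]>)%VS ->
  U = act g (std la).
Proof.
move=> ge Ue; apply: flag_eq => a; rewrite Ue /= /act_at /= /coordv limg_sum.
by apply: eq_bigr => t _; rewrite limg_line lfunE /= ge.
Qed.

(** The only point where orbits are shown to be homogeneous. In each box choose a
    complement [D i j] of the sum [Y i j] of the two smaller intersections; its
    dimension is the entry of the matrix, so a basis of it can be indexed by the elements
    of that box. By induction the vectors of the boxes below [(a, b)] span
    [U a :&: W b], and there are [d] vectors in all, so no independence argument is
    needed. *)
Lemma adapted_basis la nu U W : orbit (natmx_of la nu) (U, W) ->
  exists g, U = act g (std la) /\ W = act g (std nu).
Proof.
move=> UWo; have rk := orbit_dim _ _ UWo.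
pose Y i j := (U (lo i) :&: W (hi j) + U (hi i) :&: W (lo j))%VS.
pose D i j := ((U (hi i) :&: W (hi j)) :\: Y i j)%VS.
have UleS i : (U (lo i) <= U (hi i))%VS by apply: flag_sub; rewrite /= /bump.
have WleS i : (W (lo i) <= W (hi i))%VS by apply: flag_sub; rewrite /= /bump.
have YT i j : (Y i j <= U (hi i) :&: W (hi j))%VS.
  by rewrite subv_add; apply/andP; split; apply: capvS.
have dimD i j : \dim (D i j) = #|[pred t | (la t == i) && (nu t == j)]|.
  have := dimv_cap_compl (U (hi i) :&: W (hi j)) (Y i j).
  rewrite (capv_idPr (YT i j)) -/(D i j).
  have := dimv_sum_cap (U (lo i) :&: W (hi j)) (U (hi i) :&: W (lo j)).
  rewrite -/(Y i j) [(_ :&: _ :&: _)%VS]Monoid.mulmACA /=.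
  rewrite (capv_idPl (UleS i)) (capv_idPr (WleS j)).
  by rewrite !rk /= /bump /= !add1n; have := card_box la nu i j; lia.
pose fib i j := enum [pred t | (la t == i) && (nu t == j)].
(* The rank of [t] within its box selects its vector in the basis of [D]. *)
pose e t : V := (vbasis (D (la t) (nu t)))`_(index t (fib (la t) (nu t))).
have fibP t i j : (t \in fib i j) = (la t == i) && (nu t == j).
  by rewrite mem_enum.
have eD t : e t \in D (la t) (nu t).
  apply/vbasis_mem/mem_nth; rewrite size_tuple dimD cardE.
  by rewrite index_mem fibP !eqxx.
have De i j : (D i j <= \sum_(t | (la t == i) && (nu t == j)) <[e t]>)%VS.
  rewrite -{1}(span_basis (vbasisP (D i j))); apply/span_subvP => x /(nthP 0)[k klt <-].
  have {}klt : (k < size (fib i j))%N by rewrite -cardE -dimD -(size_tuple (vbasis (D i j))).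
  have /card_gt0P[t0 _] : (0 < #|[pred t | (la t == i) && (nu t == j)]|)%N.
    by rewrite cardE; apply: leq_ltn_trans klt.
  set t := nth t0 (fib i j) k.
  have tij : t \in fib i j by apply: mem_nth.
  have idx : index t (fib i j) = k by rewrite index_uniq ?enum_uniq.
  have [/eqP li /eqP nj] := andP (etrans (esym (fibP _ _ _)) tij).
  have -> : (vbasis (D i j))`_k = e t by rewrite /e li nj idx.
  apply: subvP (e t) (memv_line _); apply: (sumv_sup t) => //.
  by rewrite li nj !eqxx.
pose S (a b : 'I_n.+1) := (\sum_(t | (la t < a)%N && (nu t < b)%N) <[e t]>)%VS.
have lohi (i : 'I_n) : (lo i : nat).+1 = hi i by rewrite /= /bump.
have SS (a b a' b' : 'I_n.+1) : (a <= a')%N -> (b <= b')%N -> (S a b <= S a' b')%VS.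
  move=> aa bb; apply/subv_sumP => t /andP[ta tb]; apply: (sumv_sup t) => //.
  by rewrite (leq_trans ta) ?(leq_trans tb).
have capS : forall m (a b : 'I_n.+1), (a + b <= m)%N -> (U a :&: W b <= S a b)%VS.
  elim=> [|m IH] a b abm.
    have -> : a = ord0 by apply: val_inj => /=; lia.
    by rewrite flag_bot cap0v sub0v.
  case: (unliftP ord0 a) abm => [i ->|-> _]; last by rewrite flag_bot cap0v sub0v.
  case: (unliftP ord0 b) => [j ->|-> _]; last by rewrite flag_bot capv0 sub0v.
  rewrite -/(hi i) -/(hi j) -!lohi => abm.
  rewrite -(addv_diff_cap (U (hi i) :&: W (hi j)) (Y i j)) (capv_idPr (YT i j)).
  rewrite subv_add -/(D i j); apply/andP; split.
    apply: subv_trans (De i j) _; apply/subv_sumP => t /andP[/eqP ti /eqP tj].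
    by apply: (sumv_sup t) => //; rewrite ti tj -!lohi !leqnn.
  rewrite subv_add; apply/andP; split.
    by apply: subv_trans (IH _ _ _) (SS _ _ _ _ _ _); rewrite -?lohi; lia.
  by apply: subv_trans (IH _ _ _) (SS _ _ _ _ _ _); rewrite -?lohi; lia.
have capE a b : (U a :&: W b)%VS = S a b.
  apply/eqP; rewrite eqEsubv (capS (a + b)%N) //=.
  apply/subv_sumP => t /andP[ta tb]; apply: subv_trans (_ : _ <= D (la t) (nu t))%VS _.
    by rewrite -memvE.
  apply: subv_trans (diffvSl _ _) _; apply: capvS; apply: flag_sub.
    by rewrite -lohi.
  by rewrite -lohi.
have [|g ge] := @GL_of_span e.
  rewrite -(flag_top U) -[RHS]capvf -(flag_top W) capE.
  by apply: eq_bigl => t; rewrite !ltn_ord.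
exists g; split; apply: act_std ge _ => a.
  rewrite -[LHS]capvf -(flag_top W) capE.
  by apply: eq_bigl => t; rewrite ltn_ord andbT.
rewrite -[LHS]capfv -(flag_top U) capE.
by apply: eq_bigl => t; rewrite ltn_ord.
Qed.

End Flags.

(** * Uniqueness of the open orbit *)

Section Zariski.
Variables (K : fieldType) (n d : nat).
Implicit Types (la nu : 'I_d -> 'I_n) (M N L : natmx n d).
Implicit Types (U W X : flag K n d) (g h : GL K d).
Local Notation V := 'cV[K]_d.

Lemma act_mul g h k U : val h *m val g = val k -> act h (act g U) = act k U.
Proof.
move=> hg; apply: flag_eq => a; rewrite /= /act_at /= -limg_comp.
by apply: eq_in_limg => v _; rewrite lfunE /= !lfunE /= mulmxA hg.
Qed.

Definition mkGL (A : 'M[K]_d) (AU : A \in unitmx) : GL K d := exist _ A AU.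

Definition GL1 : GL K d := mkGL (unitmx1 K d).

Lemma act1 U : act GL1 U = U.
Proof.
apply: flag_eq => a; rewrite /= /act_at -[RHS]lim1g.
by apply: eq_in_limg => v _; rewrite !lfunE /= mul1mx.
Qed.

(** Both pairs are translates of the same pair of coordinate flags. *)
Lemma orbit_transitive M U X U' X' : orbit M (U, X) -> orbit M (U', X') ->
  exists g, act g U = U' /\ act g X = X'.
Proof.
have [la [nu ->]] := natmx_of_surj M.
move=> /adapted_basis[g [-> ->]] /adapted_basis[h [-> ->]].
have kU : val h *m invmx (val g) \in unitmx.
  by rewrite unitmx_mul unitmx_inv (valP g) (valP h).
exists (mkGL kU).
by split; apply: act_mul; rewrite /= mulmxKV // (valP g).
Qed.

Lemma orbit_inj L L' U W : orbit L (U, W) -> orbit L' (U, W) -> L = L'.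
Proof.
have [la [nu ->]] := natmx_of_surj L; have [la' [nu' ->]] := natmx_of_surj L'.
move=> UW UW'; apply: val_inj; apply/matrixP => i j; rewrite !mxE.
have box := card_box la nu i j; have box' := card_box la' nu' i j.
have rk a b := etrans (esym (orbit_dim a b UW)) (orbit_dim a b UW').
have := (rk (hi i) (hi j), rk (lo i) (lo j), rk (lo i) (hi j), rk (hi i) (lo j)).
by rewrite /= /bump /= !add1n => -[[[e1 e2] e3] e4]; lia.
Qed.

Lemma meval_line m (p : mpoly.mpoly m K) (v w : 'I_m -> K) :
  exists q : {poly K},
    forall t, q.[t] = mpoly.meval (fun i => v i + t * w i) p.
Proof.
exists (\sum_(k <- mpoly.msupp p) (mpoly.mcoeff k p)%:P *
  \prod_i ((v i)%:P + (w i)%:P * 'X) ^+ mpoly.fun_of_multinom k i).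
move=> t; rewrite mpoly.mevalE horner_sum; apply: eq_bigr => k _.
rewrite hornerM hornerC horner_prod; congr (_ * _); apply: eq_bigr => i _.
by rewrite horner_exp !hornerE mulrC.
Qed.

Hypothesis infK : forall s : seq K, exists x, x \notin s.

Lemma ex_nonroot (q : {poly K}) : q != 0 -> exists t, q.[t] != 0.
Proof.
move=> q0; have [s us ss] : exists2 s : seq K, uniq s & size s = size q.
  elim: (size q) => [|m [s us <-]]; first by exists [::].
  by have [x xs] := infK s; exists (x :: s); rewrite //= xs.
have /allPn[t _ qt] : ~~ all (root q) s.
  by apply/negP => /(max_poly_roots q0)/(_ us); rewrite ss ltnn.
by exists t.
Qed.

(** An open set of pairs, tested on translates of its second member along the line
    [A + t *: B] of matrices, contains a cofinite part of the invertible members of that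
    line as soon as it contains one of them. *)
Lemma open_line (Z : set (flag K n d * flag K n d)) U W (A B : 'M[K]_d) g :
    zariski_open Z -> Z (U, act g W) ->
  forall t0, val g = A + t0 *: B ->
  exists q : {poly K}, q.[t0] != 0 /\
    forall t h, val h = A + t *: B -> q.[t] != 0 -> Z (U, act h W).
Proof.
move=> Zo ZUW t0 gt; have [O [P ->] ZE] := Zo U W.
have ZP h : Z (U, act h W) <-> (exists2 p, P p &
    mpoly.meval (row_mx (mxvec 1%:M) (mxvec (val h)) 0) p != 0).
  have /(congr1 (fun S : set _ => S (GL1, h))) := ZE.
  by rewrite /= act1 => ->.
have [p Pp p0] := (ZP g).1 ZUW.
pose v : 'rV[K]_(d * d + d * d) := row_mx (mxvec 1%:M) (mxvec A).
pose w : 'rV[K]_(d * d + d * d) := row_mx 0 (mxvec B).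
have [q qE] := meval_line p (v 0) (w 0).
have line h t : val h = A + t *: B -> q.[t] =
    mpoly.meval (row_mx (mxvec 1%:M) (mxvec (val h)) 0) p.
  move=> ht; rewrite qE; congr (mpoly.meval _ p); apply/funext => i.
  have -> : v 0 i + t * w 0 i = (v + t *: w) 0 i by rewrite !mxE.
  by rewrite scale_row_mx add_row_mx scaler0 addr0 ht linearD linearZ.
exists q; split; first by rewrite (line g).
by move=> t h ht qt; apply/ZP; exists p; rewrite -?(line h t).
Qed.

Lemma det_line (A B : 'M[K]_d) :
  exists q : {poly K}, forall t, q.[t] = \det (A + t *: B).
Proof.
exists (\det (map_mx polyC A + 'X *: map_mx polyC B)) => t.
rewrite -/(horner_eval t _) -det_map_mx; congr (\det _); apply/matrixP => i j.
by rewrite !mxE /= /horner_eval !hornerE.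
Qed.

(** A weak form of the irreducibility of the stabilizer of [X]: matrices preserving [X]
    form a linear space, so the line through [1] and [h] stays in the stabilizer wherever
    it is invertible. Two open sets met at the parameters [0] and [1] are then both met at
    a generic parameter, the field being infinite. *)
Lemma generic_stab (Z Z' : set (flag K n d * flag K n d)) U W X h :
    zariski_open Z -> zariski_open Z' -> act h X = X ->
    Z (U, W) -> Z' (U, act h W) ->
  exists g, [/\ act g X = X, Z (U, act g W) & Z' (U, act g W)].
Proof.
move=> Zo Zo' hX ZUW ZUW'; pose B := val h - 1%:M.
have e0 : val GL1 = 1%:M + 0 *: B by rewrite scale0r addr0.
have e1 : val h = 1%:M + 1 *: B by rewrite scale1r addrC subrK.
rewrite -[W]act1 in ZUW.
have [q [q0 qZ]] := open_line Zo ZUW e0.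
have [q' [q1 qZ']] := open_line Zo' ZUW' e1.
have [r rE] := det_line 1%:M B.
have [|t] := @ex_nonroot (q * q' * r).
  rewrite !mulf_neq0 //; apply/eqP => q00.
  - by rewrite q00 horner0 eqxx in q0.
  - by rewrite q00 horner0 eqxx in q1.
  by have := rE 0; rewrite q00 horner0 -e0 det1 => /eqP; rewrite eq_sym oner_eq0.
rewrite !hornerM !mulf_eq0 !negb_or rE => /andP[/andP[qt qt'] rt].
have gU : 1%:M + t *: B \in unitmx by rewrite unitmxE unitfE.
exists (mkGL gU); split; last 2 first.
- exact: qZ qt.
- exact: qZ' qt'.
apply: flag_eq => a; apply/eqP; rewrite eqEdim.
have := dim_act_cap (mkGL gU) X X a a; rewrite !capvv => ->.
rewrite leqnn andbT; apply/subvP => _ /memv_imgP[v vX ->].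
rewrite lfunE /= mulmxDl mul1mx -scalemxAl memvD // memvZ // mulmxBl mul1mx.
rewrite memvB // -hX /= /act_at; apply/memv_imgP; exists v => //.
by rewrite lfunE.
Qed.

(** Transitivity on the orbits of [M] and [N] brings the two points to a common [U] and a
    common middle flag [X], the second members differing by an element [h] of the
    stabilizer of [X]. A generic translate of [W] by the stabilizer then lies in both
    orbits, while remaining in the convolution because [X] is fixed. *)
Lemma open_orbit_unique M N L L' :
  open_orbit K M N L -> open_orbit K M N L' -> L = L'.
Proof.
move=> [Lc [Z Zo LZ]] [Lc' [Z' Zo' LZ']].
have ex L0 : exists U W, @orbit K n d L0 (U, W).
  have [la [nu ->]] := natmx_of_surj L0.
  by exists (act GL1 (std K la)), (act GL1 (std K nu)); apply: orbit_std.
have [U [W UW]] := ex L; have [U' [W' UW']] := ex L'.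
have [X [UX XW]] := Lc _ UW; have [X' [UX' XW']] := Lc' _ UW'.
rewrite /= in UX XW UX' XW'.
have [k [kU kX]] := orbit_transitive UX' UX.
have {}XW' : orbit N (X, act k W') by rewrite -kX; apply/orbit_act.
have {}UW' : orbit L' (U, act k W') by rewrite -kU; apply/orbit_act.
have [h [hX hW]] := orbit_transitive XW XW'.
have ZUW : Z (U, W) by move: UW; rewrite LZ => -[].
have ZUW' : Z' (U, act h W) by rewrite hW; move: UW'; rewrite LZ' => -[].
have [g [gX gZ gZ']] := generic_stab Zo Zo' hX ZUW ZUW'.
have c : conv M N (U, act g W).
  by exists X; split => //=; rewrite -gX; apply/orbit_act.
by apply: (@orbit_inj L L' U (act g W)); rewrite ?LZ ?LZ'.
Qed.

End Zariski.

(** * Semicontinuity of the dimension of intersections *)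

Section Semicontinuity.
Variables (K : fieldType) (n d : nat).
Implicit Types (la nu : 'I_d -> 'I_n) (M N L : natmx n d).
Implicit Types (U W X : flag K n d) (g h : GL K d).
Local Notation V := 'cV[K]_d.

(** In this form a rank condition involves nothing but the nonvanishing of
    determinants. Part of a basis of [Y], paired with its coordinate forms, gives the
    identity matrix. *)
Lemma leq_dimP (Y : {vspace V}) s :
  (s <= \dim Y)%N <->
  exists (C : 'M[K]_(s, d)) (E : 'M[K]_(d, s)),
    (forall j, col j E \in Y) /\ \det (C *m E) != 0.
Proof.
split=> [sY|[C [E [EY CE]]]].
  pose X := vbasis Y; pose w := widen_ord sY.
  exists (\matrix_(i, k) coord X (w i) (delta_mx k ord0)).
  exists (\matrix_(i, j) X`_(w j) i ord0); split=> [j|].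
    rewrite (_ : col j _ = X`_(w j)); first by rewrite vbasis_mem // mem_nth // size_tuple.
    by apply/colP => i; rewrite !mxE.
  rewrite (_ : _ *m _ = 1%:M) ?det1 ?oner_eq0 //; apply/matrixP => i j.
  have lin (v : V) : coord X (w i) v = \sum_k coord X (w i) (delta_mx k ord0) * v k ord0.
    rewrite {1}[v]matrix_sum_delta linear_sum /=; apply: eq_bigr => k _.
    by rewrite big_ord1 linearZ mulrC.
  transitivity (coord X (w i) X`_(w j)); last first.
    by rewrite coord_free ?(basis_free (vbasisP Y)) // mxE eq_sym.
  rewrite lin mxE; by apply: eq_bigr => k _; rewrite !mxE.
pose f := linfun (mulmx E : 'cV_s -> V).
have CEu : C *m E \in unitmx by rewrite unitmxE unitfE.
have kf : lker f == 0%VS.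
  apply/lker0P => x y; rewrite !lfunE /= => xy.
  by rewrite -[x](mulKmx CEu) -[y](mulKmx CEu) -!mulmxA xy.
have /dimvS : (limg f <= Y)%VS.
  apply/subvP => _ /memv_imgP[x _ ->]; rewrite lfunE /=.
  have -> : E *m x = \sum_j x j ord0 *: col j E.
    apply/colP => i; rewrite summxE !mxE; apply: eq_bigr => j _.
    by rewrite !mxE mulrC.
  by apply: memv_suml => j _; apply/memvZ/EY.
by rewrite limg_dim_eq ?(eqP kf) ?capv0 // dimvf /dim /= muln1.
Qed.

(** The intersection is small iff the sum of the two translates is large, and
    vectors of this sum are [g x + h y] with [x], [y] in the fixed subspaces [S], [T]:
    for fixed [C], [a], [b] the determinant is a polynomial in the entries of [g] and
    [h]. If the truncated difference is zero, both sides hold, the empty determinant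
    being [1]. *)
Lemma dim_cap_leP (S T : {vspace V}) r g h :
  (\dim (linfun (mulmx (val g) : V -> V) @: S :&:
         linfun (mulmx (val h) : V -> V) @: T) <= r)%N <->
  exists (C : 'M[K]_(\dim S + \dim T - r, d)) a b,
    [/\ forall j, col j a \in S, forall j, col j b \in T &
        \det (C *m (val g *m a + val h *m b)) != 0].
Proof.
set G := linfun _; set H := linfun _.
have -> : (\dim (G @: S :&: H @: T) <= r)%N =
          (\dim S + \dim T - r <= \dim (G @: S + H @: T))%N.
  have dimGL k Y : \dim (linfun (mulmx (val (k : GL K d)) : V -> V) @: Y) = \dim Y.
    by rewrite limg_dim_eq // (eqP (lker_GL k)) capv0.
  have := dimv_sum_cap (G @: S) (H @: T); rewrite !dimGL.
  by move=> e; rewrite leq_subLR -e addnC leq_add2r.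
rewrite leq_dimP; split=> [[C [E [EY CE]]]|[C [a [b [aS bT Cab]]]]].
  have /fin_all_exists[f fP] j : exists xy : V * V,
      [/\ xy.1 \in S, xy.2 \in T & col j E = val g *m xy.1 + val h *m xy.2].
    have /memv_addP[_ /memv_imgP[x xS ->] [_ /memv_imgP[y yT ->] ->]] := EY j.
    by exists (x, y); rewrite /G /H !lfunE.
  exists C, (\matrix_(i, j) (f j).1 i ord0), (\matrix_(i, j) (f j).2 i ord0).
  have c1 j : col j (\matrix_(i, j) (f j).1 i ord0) = (f j).1.
    by apply/colP => i; rewrite !mxE.
  have c2 j : col j (\matrix_(i, j) (f j).2 i ord0) = (f j).2.
    by apply/colP => i; rewrite !mxE.
  split=> [j|j|]; try by have [? ? ?] := fP j; rewrite ?c1 ?c2.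
  rewrite (_ : _ + _ = E) //; apply/matrixP => i j.
  have [_ _] := fP j; rewrite -c1 -c2 !colE !mulmxA -mulmxDl -!colE.
  by move=> /colP/(_ i); rewrite [LHS]mxE [RHS]mxE.
exists C, (val g *m a + val h *m b); split=> // j.
rewrite colE mulmxDl -!mulmxA -!colE memv_add //; apply/memv_imgP.
  by exists (col j a); rewrite ?lfunE.
by exists (col j b); rewrite ?lfunE.
Qed.

Definition cap_le (r : 'I_n.+1 -> 'I_n.+1 -> nat) : set (flag K n d * flag K n d) :=
  [set UW : flag K n d * flag K n d | forall a b, (\dim (UW.1 a :&: UW.2 b)%VS <= r a b)%N]%classic.

(** Finitely many conditions, each expressed by the nonvanishing of some member of a
    family of polynomials; the products of one member from each family express their
    conjunction. *)
Lemma cap_le_open r : zariski_open (cap_le r).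
Proof.
move=> U W; pose m := (d * d + d * d)%N.
pose Xm k : mpoly.mpoly m K := mpoly.mpolyX K (mpoly.mnm1 k).
pose G : 'M_d := \matrix_(i, j) Xm (lshift _ (mxvec_index i j)).
pose H : 'M_d := \matrix_(i, j) Xm (rshift _ (mxvec_index i j)).
(* The generic matrices [G] and [H] are multiplied by matrices of constants [c A]. *)
pose c p q (A : 'M[K]_(p, q)) := map_mx (mpoly.mpolyC m (R := K)) A.
pose P (ab : 'I_n.+1 * 'I_n.+1) (p : mpoly.mpoly m K) :=
  exists (C : 'M[K]_(\dim (U ab.1) + \dim (W ab.2) - r ab.1 ab.2, d)) a b,
    [/\ forall j, col j a \in U ab.1, forall j, col j b \in W ab.2 &
        p = \det (c _ _ C *m (G *m c _ _ a + H *m c _ _ b))].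
exists [set v | exists2 p, (exists2 f, (forall ab, P ab (f ab)) & p = \prod_ab f ab)
   & mpoly.meval (v ord0) p != 0]%classic; first by eexists.
pose v g h : 'I_m -> K := row_mx (mxvec (val g)) (mxvec (val h)) ord0.
have evC g h p q (A : 'M[K]_(p, q)) : map_mx (mpoly.meval (v g h)) (c p q A) = A.
  by apply/matrixP => i j; rewrite !mxE mpoly.mevalC.
have evG g h : map_mx (mpoly.meval (v g h)) G = val g.
  by apply/matrixP => i j; rewrite !mxE mpoly.mevalXU /v row_mxEl mxvecE.
have evH g h : map_mx (mpoly.meval (v g h)) H = val h.
  by apply/matrixP => i j; rewrite !mxE mpoly.mevalXU /v row_mxEr mxvecE.
have ev g h s (C : 'M_(s, d)) a b :
    mpoly.meval (v g h) (\det (c _ _ C *m (G *m c _ _ a + H *m c _ _ b))) =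
    \det (C *m (val g *m a + val h *m b)).
  by rewrite -det_map_mx map_mxM map_mxD !map_mxM !evC evG evH.
apply/seteqP; split=> -[g h] /=.
  move=> le.
  have /fin_all_exists2[f fP f0] ab :
      exists2 p, P ab p & mpoly.meval (v g h) p != 0.
    have /dim_cap_leP[C [a [b [aU bW det0]]]] := le ab.1 ab.2.
    by eexists; [exists C, a, b; split=> // | rewrite ev].
  exists (\prod_ab f ab); first by exists f.
  by rewrite rmorph_prod; apply/prodf_neq0 => ab _; apply: f0.
case=> _ [f fP ->]; rewrite rmorph_prod => /prodf_neq0 f0 a b.
have [C [a' [b' [aU bW fE]]]] := fP (a, b).
apply/dim_cap_leP; exists C, a', b'; split=> //.
by rewrite -ev -fE; apply: f0.
Qed.

End Semicontinuity.

(** * Products by almost diagonal matrices, and the factorization *)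

Section Moves.
Variables n d : nat.
Implicit Types (la nu : 'I_d -> 'I_n) (k : 'I_n).

Definition relabel la t0 k : 'I_d -> 'I_n := fun t => if t == t0 then k else la t.

Lemma row_sums_natmx_of la nu i : row_sums (natmx_of la nu) ord0 i = #|[pred t | la t == i]|.
Proof.
rewrite mxE -(@big_pred1_eq _ _ addn _ i (fun i => \sum_j label_mx la nu i j)%N).
by rewrite sum_label_mx; apply: eq_card => t; rewrite !inE andbT.
Qed.

Lemma col_sums_natmx_of la nu j : col_sums (natmx_of la nu) ord0 j = #|[pred t | nu t == j]|.
Proof.
rewrite mxE; under eq_bigr => i _.
  rewrite -(@big_pred1_eq _ _ addn _ j (fun j => label_mx la nu i j)).
  over.
by rewrite sum_label_mx; apply: eq_card => t; rewrite !inE.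
Qed.

Lemma relabel_almost_diagonal la t0 k :
    (la t0).+1 = k \/ k.+1 = la t0 ->
  almost_diagonal (natmx_of la (relabel la t0 k)).
Proof.
pose mu : 'rV[nat]_n := \row_i #|[pred t | (t != t0) && (la t == i)]|.
have mu_sum : (\sum_i mu ord0 i)%N = d.-1.
  under eq_bigr => i _ do rewrite mxE.
  transitivity (\sum_i \sum_(t | la t == i) (t != t0))%N.
    apply: eq_bigr => i _; rewrite -card_and; apply: eq_card => t.
    by rewrite !inE andbC.
  rewrite (sum_fibers (fun t => (t != t0) : nat) la predT).
  transitivity #|[predD1 predT & t0]|; last first.
    by have := cardD1 t0 predT; rewrite card_ord inE add1n => /(congr1 predn).
  by rewrite -big_mkcond sum1_card; apply: eq_card => t; rewrite !inE andbT.
have muE : label_mx la (relabel la t0 k) = diag_mx mu + delta_mx (la t0) k.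
  apply/matrixP => i j; rewrite !mxE (cardD1 t0) inE /= {1}/relabel eqxx addnC.
  congr (_ + _)%N; last by rewrite [la t0 == i]eq_sym [k == j]eq_sym; case: andP.
  rewrite /relabel.
  case: (i =P j) => [->|ij].
    by rewrite mulr1n; apply: eq_card => t; rewrite !inE; case: eqP => //= _; rewrite andbb.
  rewrite mulr0n; apply: eq_card0 => t; rewrite !inE; case: eqP => //= _.
  by apply/negP => /andP[/eqP-> /eqP].
case=> [kE|kE]; first by exists mu, (la t0), k; split=> //; left.
by exists mu, k, (la t0); split=> //; right.
Qed.

Lemma diagonal_natmx_of la nu : la =1 nu -> diagonal (natmx_of la nu).
Proof.
move=> lanu; apply/is_diag_mxP => i j ij; rewrite mxE; apply: eq_card0 => t.
by rewrite !inE -lanu; apply/negP => /andP[/eqP-> /eqP lj]; rewrite lj eqxx in ij.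
Qed.

Variable K : fieldType.
Implicit Types U X W : flag K n d.
Local Notation V := 'cV[K]_d.

(** The codimension of a subspace can only drop when both spaces are cut by [Y]. *)
Lemma dim_cap_lower (S T Y : {vspace V}) : (S <= T)%VS ->
  (\dim S + \dim (T :&: Y) <= \dim (S :&: Y) + \dim T)%N.
Proof.
move=> ST; rewrite -dimv_sum_cap capvA (capv_idPl ST) addnC leq_add2l.
by apply: dimvS; rewrite subv_add ST capvSl.
Qed.

(** As the orbit of [(la, nu)] always lies in the convolution, this makes it the most
    generic orbit there. *)
Definition conv_rank_ge la la' nu :=
  forall U W, conv (natmx_of la la') (natmx_of la' nu) (U, W) -> forall a b : 'I_n.+1,
    (#|[pred t | (la t < a)%N && (nu t < b)%N]| <= \dim (U a :&: W b))%N.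

(** Lower bound by [U a :&: X a :&: W b], where [U a :&: X a] and [X a :&: W b] have known
    dimension inside [X a]. The hypothesis says that this bound suffices, and is stated
    element by element. *)
Lemma conv_rank_ge_at la la' nu U X W (a b : 'I_n.+1) :
    orbit (natmx_of la la') (U, X) -> orbit (natmx_of la' nu) (X, W) ->
    (forall t, ((la t < a) && (nu t < b)) + (la' t < a) <=
               ((la t < a) && (la' t < a)) + ((la' t < a) && (nu t < b)))%N ->
  (#|[pred t | (la t < a)%N && (nu t < b)%N]| <= \dim (U a :&: W b))%N.
Proof.
move=> UX XW /leq_card2; rewrite -(orbit_dim _ _ UX) -(orbit_dim _ _ XW).
rewrite -(orbit_dimr _ UX) => le.
have := dim_cap_lower (W b) (capvSr (U a) (X a)).
have : (\dim (U a :&: X a :&: W b) <= \dim (U a :&: W b))%N.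
  by apply/dimvS/capvS; first exact: capvSl.
lia.
Qed.

(** Only the step [a] of the flag with [la t0 < a <= k] distinguishes [la] from its
    relabeling; there the bound through [X a] misses one dimension for the columns beyond
    [nu t0]. For those columns [W b] contributes everything it can in row [k], by the
    hypothesis, and the step [U a] of [U], seen inside the next step, supplies the
    missing dimension. *)
Lemma conv_rank_ge_up la nu t0 k : (la t0).+1 = k ->
    (forall t, la t = k -> (nu t <= nu t0)%N) -> conv_rank_ge la (relabel la t0 k) nu.
Proof.
move=> kE kmax U W [X /= [UX XW]] a b.
have noncross (c : 'I_n.+1) : (la t0 < c)%N = (k < c)%N ->
    (#|[pred t | (la t < c)%N && (nu t < b)%N]| <= \dim (U c :&: W b))%N.
  move=> kc; apply: (conv_rank_ge_at UX XW) => t.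
  by rewrite /relabel; case: (t =P t0) => [->|_]; rewrite -?kc; lia.
have [kc|kc] := eqVneq (la t0 < a)%N (k < a)%N; first exact: noncross.
have ak : a = k :> nat by lia.
have [b0|b0] := leqP b (nu t0).
  apply: (conv_rank_ge_at UX XW) => t.
  by rewrite /relabel; case: (t =P t0) => [->|_]; lia.
pose a1 := hi k; have a1E : a1 = k.+1 :> nat by [].
have aa1 : (U a <= U a1)%VS by apply: flag_sub; rewrite a1E ak.
have lea1 := noncross a1; have := dim_cap_lower (W b) aa1.
rewrite !(orbit_diml _ UX).
have : (#|[pred t | (la t < a)%N && (nu t < b)%N]| + #|[pred t | (la t < a1)%N]| <=
  #|[pred t | (la t < a)%N]| + #|[pred t | (la t < a1)%N && (nu t < b)%N]|)%N.
  apply: leq_card2 => t; rewrite a1E ak.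
  have [lat|] := eqVneq (la t) k; last by rewrite -val_eqE /=; lia.
  by have := kmax t lat; rewrite lat; lia.
by have := lea1 _; rewrite a1E; lia.
Qed.

(** Dual to the upward case: at the critical step the bound through [X a] fails only up
    to the column [nu t0]. There row [k] contributes nothing, by the hypothesis, so the
    previous step of [U] is already large enough. *)
Lemma conv_rank_ge_down la nu t0 k : k.+1 = la t0 ->
    (forall t, la t = k -> (nu t0 <= nu t)%N) -> conv_rank_ge la (relabel la t0 k) nu.
Proof.
move=> kE kmin U W [X /= [UX XW]] a b.
have noncross (c : 'I_n.+1) : (la t0 < c)%N = (k < c)%N ->
    (#|[pred t | (la t < c)%N && (nu t < b)%N]| <= \dim (U c :&: W b))%N.
  move=> kc; apply: (conv_rank_ge_at UX XW) => t.
  by rewrite /relabel; case: (t =P t0) => [->|_]; rewrite -?kc; lia.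
have [kc|kc] := eqVneq (la t0 < a)%N (k < a)%N; first exact: noncross.
have ak : a = k.+1 :> nat by lia.
have [b0|b0] := ltnP (nu t0) b.
  apply: (conv_rank_ge_at UX XW) => t.
  by rewrite /relabel; case: (t =P t0) => [->|_]; lia.
pose a0 := lo k; have a0E : a0 = k :> nat by [].
have : (\dim (U a0 :&: W b) <= \dim (U a :&: W b))%N.
  by apply/dimvS/capvS => //; apply: flag_sub; rewrite a0E ak.
apply: leq_trans; apply: leq_trans (noncross a0 _); last by rewrite a0E; lia.
apply/subset_leq_card/fintype.subsetP => t; rewrite !inE a0E ak => /andP[lat nut].
rewrite nut andbT ltn_neqAle -ltnS lat andbT; apply/negP => /eqP/val_inj/kmin.
by lia.
Qed.

Hypothesis infK : forall s : seq K, exists x, x \notin s.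

(** The orbit of [(la, nu)] lies in the convolution, with the coordinate flag of [la'] as
    middle flag; minimality of its intersections makes it the trace of the open set where
    the intersections are at most as large. *)
Lemma circ_natmx_of la la' nu : conv_rank_ge la la' nu ->
  circ K (natmx_of la la') (natmx_of la' nu) = Some (natmx_of la nu).
Proof.
move=> dom; rewrite /circ ifT; last first.
  by apply/eqP/rowP => i; rewrite row_sums_natmx_of col_sums_natmx_of.
have op : open_orbit K (natmx_of la la') (natmx_of la' nu) (natmx_of la nu).
  split.
    move=> [U W] /adapted_basis[g [/= -> ->]].
    by exists (act g (std K la')); split; apply: orbit_std.
  exists (cap_le (fun a b => #|[pred t | (la t < a)%N && (nu t < b)%N]|)).
    exact: cap_le_open.
  apply/seteqP; split=> -[U W].
    move=> UW; split; first by move=> a b; rewrite (orbit_dim _ _ UW).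
    have [g [-> ->]] := adapted_basis UW.
    by exists (act g (std K la')); split; apply: orbit_std.
  move=> [Z UW] a b; apply/eqP.
  rewrite (sum_label_mx la nu (fun i => i < a)%N (fun j => j < b)%N).
  by rewrite eqn_leq Z (dom _ _ UW).
apply: xget_unique.
  by exists (natmx_of la nu) => //; split=> // L'; apply: open_orbit_unique.
by move=> _ [L' [opL' _] <-]; congr Some; apply: (open_orbit_unique infK opL').
Qed.

(** Each step splits off on the left an almost diagonal factor that moves one element one
    row closer to its column. If some element has a row smaller than its column, take
    one with the largest row: in the next row no element is above its diagonal
    position, as the hypothesis of [conv_rank_ge_up] requires. Otherwise, take an element
    with row larger than column and with the smallest row: in the previous row all
    elements are diagonal. Without such elements the matrix is diagonal. *)
Lemma factorization la nu : exists (A : natmx n d) (s : seq (natmx n d)),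
  (forall B, B \in A :: s -> diagonal B \/ almost_diagonal B) /\
  circ_prod K A s = Some (natmx_of la nu).
Proof.
have [m] := ubnP (\sum_t ((la t - nu t) + (nu t - la t)))%N.
elim: m la => // m IH la lam.
have [/forallP lanu|] := boolP [forall t, la t == nu t].
  exists (natmx_of la nu), [::]; split=> // B; rewrite inE => /eqP->; left.
  by apply: diagonal_natmx_of => t; apply/eqP.
rewrite negb_forall => /existsP[t1 t1P].
suff [t0 [k [tk dom closer]]] : exists t0 k,
    [/\ (la t0).+1 = k \/ k.+1 = la t0, conv_rank_ge la (relabel la t0 k) nu &
        ((k - nu t0) + (nu t0 - k) < (la t0 - nu t0) + (nu t0 - la t0))%N].
  have [|A [s [sP sE]]] := IH (relabel la t0 k).
    move: lam; rewrite ltnS; apply: leq_trans.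
    rewrite (bigD1 t0) //= [X in (_ <= X)%N](bigD1 t0) //=.
    rewrite {1 2}/relabel eqxx -addSn leq_add //; apply: leq_sum => t tt0.
    by rewrite /relabel (negPf tt0).
  exists (natmx_of la (relabel la t0 k)), (A :: s); split=> [B|].
    by rewrite inE => /orP[/eqP->|/sP//]; right; apply: relabel_almost_diagonal.
  by rewrite /= -/(circ_prod K A s) sE /= circ_natmx_of.
have [/existsP[t2 t2P]|/existsPn up] := boolP [exists t, (la t < nu t)%N].
  have [t0 t0P t0max] := @arg_maxnP _ t2 (fun t => la t < nu t)%N (fun t => la t) t2P.
  have kn : ((la t0).+1 < n)%N by apply: leq_ltn_trans (ltn_ord (nu t0)).
  exists t0, (Ordinal kn); split=> /=; [by left | | lia].
  apply: conv_rank_ge_up => // t lat.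
  have := t0max t; rewrite lat /=; have := congr1 val lat => /=; lia.
have t1P' : (nu t1 < la t1)%N by have := up t1; rewrite -val_eqE /= in t1P *; lia.
have [t0 t0P t0min] := @arg_minnP _ t1 (fun t => nu t < la t)%N (fun t => la t) t1P'.
have kn : ((la t0).-1 < n)%N by apply: leq_ltn_trans (leq_pred _) (ltn_ord (la t0)).
exists t0, (Ordinal kn); split=> /=; [by right; lia | | lia].
apply: conv_rank_ge_down => /= [|t lat]; first by lia.
have := t0min t; have := up t; have := congr1 val lat => /=; lia.
Qed.

End Moves.

Lemma infinite_num (F : numFieldType) (s : seq F) : exists x, x \notin s.
Proof.
pose r : seq F := [seq i%:R | i <- iota 0 (size s).+1].
have ur : uniq r.
  rewrite map_inj_uniq ?iota_uniq // => i j ij.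
  by apply/eqP; rewrite -(Num.Theory.eqr_nat F) ij.
have /allPn[x _ xs] : ~~ all (mem s) r.
  apply/negP => /allP rs; have := uniq_leq_size ur rs.
  by rewrite size_map size_iota ltnn.
by exists x.
Qed.

Theorem theoremB (R : realType) (n d : nat) (hn : (0 < n)%N) (hd : (0 < d)%N)
    (M : natmx n d) :
  exists (A : natmx n d) (s : seq (natmx n d)),
    (forall B : natmx n d, B \in A :: s -> diagonal B \/ almost_diagonal B) /\
    circ_prod R[i] A s = Some M.
Proof.
have [la [nu ->]] := natmx_of_surj M; apply: factorization => s.
exact: infinite_num.
Qed.
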